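(* Assume $\mathfrak p=\mathfrak c$ (e.g. CH). Then there exist a set of reals $X$ of cardinality $\mathfrak c$ and a countable subset $Q\subseteq X$ such that $X$ satisfies $\binom{\Omega}{\Gamma}$ while $X\setminus Q$ does not satisfy $\mathrm{Split}(C_{\mathrm T},C_{\mathrm T})$.
   Context: A set of reals is an infinite topological space homeomorphic to a subset of $\mathbb R$. A cover of a space $X$ is a family $\mathcal U$ of subsets of $X$ with $\bigcup\mathcal U=X$ such that $X\not\subseteq U$ for all $U\in\mathcal U$. A cover $\mathcal U$ is: an $\omega$-cover if every finite subset of $X$ is contained in some member; a $\tau$-cover if every $x\in X$ lies in infinitely many members and for all $x,y\in X$ at least one of $\{U\in\mathcal U: x\in U, y\notin U\}$, $\{U\in\mathcal U: y\in U, x\notin U\}$ is finite; a $\gamma$-cover if it is infinite and each $x\in X$ lies in all but finitely many members. $\Omega,\Gamma$ are the collections of open $\omega$-covers and open $\gamma$-covers of $X$; $C_{\mathrm T}$ is the collection of countable clopen $\tau$-covers of $X$. $X$ satisfies $\binom{\mathfrak U}{\mathfrak V}$ if every $\mathcal U\in\mathfrak U$ has a subfamily in $\mathfrak V$; $X$ satisfies $\mathrm{Split}(\mathfrak U,\mathfrak V)$ if every $\mathcal U\in\mathfrak U$ can be partitioned into two disjoint subfamilies each containing a subfamily in $\mathfrak V$. $\mathfrak p$ is the minimal cardinality of a family $F$ of infinite subsets of $\mathbb N$ such that every finite intersection of members of $F$ is infinite but there is no infinite $a\subseteq\mathbb N$ with $a\setminus y$ finite for all $y\in F$; $\mathfrak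 c=2^{\aleph_0}$. *)

(* Defs.v *)
From HB Require Import structures.
From mathcomp Require Import all_boot all_order all_algebra.
From mathcomp Require Import all_classical all_reals all_analysis.
Set Implicit Arguments. Unset Strict Implicit. Unset Printing Implicit Defensive.
Import numFieldNormedType.Exports.
Local Open Scope classical_set_scope.
Local Open Scope card_scope.

(* The hypothesis p = c.  Since p <= c holds in ZFC, p = c says that every
   family F of infinite subsets of nat with the strong finite intersection
   property and no infinite pseudo-intersection has cardinality >= c. *)
Definition sfip (F : set (set nat)) : Prop :=
  (forall A, F A -> infinite_set A) /\
  (forall G : set (set nat), G `<=` F -> finite_set G -> G !=set0 ->
      infinite_set (\bigcap_(A in G) A)).

Definition has_pseudo_intersection (F : set (set nat)) : Prop :=
  exists a : set nat, infinite_set a /\ forall y, F y -> finite_set (a `\` y).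

Definition p_eq_c : Prop :=
  forall F : set (set nat), sfip F -> ~ has_pseudo_intersection F ->
    [set: set nat] #<= F.

Section Covers.
Variable R : realType.

Definition rel_open (X U : set R) : Prop := exists V : set R, open V /\ U = V `&` X.
Definition rel_closed (X U : set R) : Prop := exists V : set R, closed V /\ U = V `&` X.

Definition is_cover (X : set R) (U : set (set R)) : Prop :=
  (forall u, U u -> u `<=` X /\ ~ (X `<=` u)) /\ \bigcup_(u in U) u = X.

Definition omega_cover (X : set R) (U : set (set R)) : Prop :=
  is_cover X U /\
  forall F : set R, finite_set F -> F `<=` X -> exists u, U u /\ F `<=` u.

Definition tau_cover (X : set R) (U : set (set R)) : Prop :=
  is_cover X U /\
  (forall x, X x -> infinite_set [set u | U u /\ u x]) /\
  (forall x y, X x -> X y ->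
     finite_set [set u | U u /\ u x /\ ~ u y] \/
     finite_set [set u | U u /\ u y /\ ~ u x]).

Definition gamma_cover (X : set R) (U : set (set R)) : Prop :=
  is_cover X U /\ infinite_set U /\
  (forall x, X x -> finite_set [set u | U u /\ ~ u x]).

Definition OmegaO (X : set R) (U : set (set R)) : Prop :=
  omega_cover X U /\ (forall u, U u -> rel_open X u).
Definition GammaO (X : set R) (U : set (set R)) : Prop :=
  gamma_cover X U /\ (forall u, U u -> rel_open X u).
Definition CT (X : set R) (U : set (set R)) : Prop :=
  tau_cover X U /\ countable U /\
  (forall u, U u -> rel_open X u /\ rel_closed X u).

Definition sel_binom (A B : set R -> set (set R) -> Prop) (X : set R) : Prop :=
  forall U, A X U -> exists V, V `<=` U /\ B X V.

Definition sel_split (A B : set R -> set (set R) -> Prop) (X : set R) : Prop :=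
  forall U, A X U -> exists V W : set (set R),
    V `|` W = U /\ V `&` W = set0 /\
    (exists V', V' `<=` V /\ B X V') /\ (exists W', W' `<=` W /\ B X W').

End Covers.

(* Main.v *)
(** Identify P(nat) with the Cantor set. Under p = c, build by transfinite
    recursion a tower T = (x_t) of length c, decreasing modulo finite, such that
    every S is almost contained in, or almost disjoint from, some x_t; moreover,
    following Galvin and Miller, whenever a family of clopen sets is an
    omega-cover of the finite sets and the earlier x_s, the next x_t is chosen so
    thin that a subsequence of the family eventually contains every y almost
    contained in x_t, hence all later members of the tower. Then T together with
    Q, the finite sets, satisfies binom(Omega, Gamma). On T alone the sets
    {x : n in x} form a clopen tau-cover because T is a chain modulo finite; a
    splitting of this cover would give a set S and its complement both meeting
    every x_t infinitely often, against the choice of T. *)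

Require Import Defs.
From HB Require Import structures.
From mathcomp Require Import all_boot all_order all_algebra.
From mathcomp Require Import wochoice.
From mathcomp Require Import all_classical all_reals all_analysis.
From mathcomp Require Import zify ring lra.
Import numFieldNormedType.Exports.
Local Open Scope classical_set_scope.
Local Open Scope card_scope.
Set Implicit Arguments.
Unset Strict Implicit.

(** * Transfinite recursion and the cardinality of the continuum *)

(** The requirement at [t] depends only on the set of earlier values, and [x0] is taken where
    nothing meets it; existence can then be proved afterwards, by induction along the finished
    sequence. *)
Lemma wf_choice {I T : Type} (lt : I -> I -> Prop) (P : I -> set T -> T -> Prop)
    (x0 : T) : well_founded lt ->
  exists x : I -> T, forall t, (exists y, P t (x @` [set s | lt s t]) y) ->
    P t (x @` [set s | lt s t]) (x t).
Proof.
elim/Pchoice: T => T in P x0 *.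
move=> wf.
pose step t (rec : forall s, lt s t -> T) : T :=
  xget x0 (P t [set y | exists s (h : lt s t), y = rec s h]).
pose x := Fix wf (fun=> T) step.
have xE t : x t = xget x0 (P t (x @` [set s | lt s t])).
  rewrite /x Fix_eq.
    rewrite /step; congr (xget x0 (P t _)); apply/seteqP; split => y.
      by case=> s [h ->]; exists s.
    by case=> s h <-; exists s, h.
  move=> u f g fg; rewrite /step; congr (xget x0 (P u _)).
  apply/seteqP; split => y; by case=> s [h ->]; exists s, h; rewrite fg.
exists x => t ex; have := xgetPex x0 ex; rewrite -xE; exact.
Qed.

Lemma card_le_inj {T U} (A : set T) (f : T -> U) (B : set U) :
  {in A &, injective f} -> f @` A `<=` B -> A #<= B.
Proof.
move=> finj fAB; apply: (@card_le_trans _ _ _ (f @` A)).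
  by rewrite (card_le_eqr (inj_card_eq finj)).
exact: subset_card_le.
Qed.

(* Cutting a well-order of [set nat] at its first initial segment of full
   cardinality leaves only initial segments of smaller cardinality. *)
Lemma short_well_order : exists (I : Type) (lt : I -> I -> Prop) (e : I -> set nat),
  [/\ well_founded lt, forall s t, s = t \/ lt s t \/ lt t s,
      forall t, ~ ([set: set nat] #<= [set s | lt s t]) & forall S, exists t, e t = S].
Proof.
have [R woR] := well_ordering_principle (set nat).
have woc : wo_chain R xpredT by move=> A _; exact: woR.
have Rtot : total R by move=> s t; apply: (wo_chainW woc).
have Ranti : antisymmetric R by move=> s t; apply: (wo_chain_antisymmetric woc).
pose lt s t := R s t && (s != t).
have ltT s t : s = t \/ lt s t \/ lt t s.
  have [->|st] := eqVneq s t; [by left|right].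
  by rewrite /lt st eq_sym st !andbT; apply/orP/Rtot.
have wflt : well_founded lt.
  move=> s; apply: contrapT => nacc.
  have [|t [[tA tmin] _]] := woR [pred t | `[< ~ Acc lt t >]].
    by exists s; apply/asboolP.
  have /asboolP := tA; apply; constructor => u /andP[Rut ut].
  apply: contrapT => nu; have /tmin Rtu : u \in [pred t | `[< ~ Acc lt t >]].
    exact/asboolP.
  by move/eqP: ut; apply; apply: Ranti; rewrite Rut.
have [[t0 bt0]|nob] := pselect (exists t, [set: set nat] #<= [set s | lt s t]).
  have [t [bt tmin]] : exists t, [set: set nat] #<= [set s | lt s t] /\
      forall s, lt s t -> ~ ([set: set nat] #<= [set u | lt u s]).
    elim/(well_founded_ind wflt) : t0 bt0 => t IH bt.
    have [[s [st bs]]|ns] := pselect (exists s, lt s t /\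
      [set: set nat] #<= [set u | lt u s]); first exact: IH bs.
    by exists t; split => // s st bs; apply: ns; exists s.
  have /pcard_surjP[e esurj] := bt.
  exists {s | lt s t}, (fun a b => lt (sval a) (sval b)), (fun a => e (sval a)).
  split.
  - move=> [s st]; elim/(well_founded_ind wflt): s st => s IH st.
    by constructor => -[u ut] us; exact: IH.
  - move=> a b; have [ab|] := ltT (sval a) (sval b); last by right.
    by case: a b ab => [a pa] [b pb] /= ab; left; exact: eq_exist.
  - move=> [s st] /= /card_le_trans h; apply: (tmin s st); apply: h.
    apply: (@card_le_inj _ _ _ sval) => [[a ha] [b hb] _ _ /= ab|_ [a ha <-]//].
    exact: eq_exist.
  - by move=> S; have [s st es] := esurj S I; exists (exist _ s st).
exists (set nat), lt, id; split => //.
- by move=> t bt; apply: nob; exists t.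
- by move=> S; exists S.
Qed.

(* A form of König's theorem: the continuum has uncountable cofinality. *)
Lemma continuum_cofinality {T : Type} (A : nat -> set T) :
  [set: set nat] #<= \bigcup_n A n -> exists n, [set: set nat] #<= A n.
Proof.
elim/Ppointed: T => T in A *.
  by rewrite emptyE => /eqP/seteqP[/(_ set0 I)].
move=> /pcard_leP[h]; apply: contrapT => nA.
(* Pairing cuts a set into countably many sections. [A n] is too small for its [n]-th sections to
   exhaust all sets, so some [b n] is left out; the set glued from the [b n] has its image outside
   every [A n]. *)
pose sec (n : nat) (S : set nat) : set nat := [set i : nat | S (pickle (n, i))].
have /choice[b bP] n : exists b : set nat, forall S, A n (h S) -> sec n S <> b.
  apply: contrapT => nb; apply: nA; exists n.
  apply: (@card_le_trans _ _ _ (h @^-1` A n)).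
    apply: card_le_trans (card_image_le (sec n) _); apply: subset_card_le => b _.
    apply: contrapT => nbb; apply: nb; exists b => S hS secb.
    by apply: nbb; exists S.
  apply: (@card_le_inj _ _ _ h) => [S S' _ _|_ [S hS <-]//].
  by apply: inj; rewrite inE.
pose S := [set k | exists n i, k = pickle (n : nat, i : nat) /\ b n i].
have [n _ hS] : (\bigcup_n A n) (h S) by apply: funS.
apply: (bP n S hS); apply/seteqP; split => i /=.
  by case=> n' [i' [/(pcan_inj pickleK)[-> ->]]].
by move=> bi; exists n, i.
Qed.

Lemma card_le_setU_countable {T : Type} (A B : set T) : countable B ->
  [set: set nat] #<= A `|` B -> [set: set nat] #<= A.
Proof.
move=> cB; have /(_ (fun n => if n is 0%N then A else B)) := @continuum_cofinality T.
have -> : \bigcup_n (fun n => if n is 0%N then A else B) n = A `|` B.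
  apply/seteqP; split => [x [[|n] _]|x [Ax|Bx]]; [by left|by right| |].
  - by exists 0%N.
  - by exists 1%N.
move=> /[apply] -[[//|n]] /card_le_trans /(_ cB) /pcard_leP[h]; exfalso.
pose d := [set n | exists S, h S = n /\ ~ S n].
have [dh|ndh] := pselect (d (h d)).
  have [S [/inj Sd]] := dh; rewrite Sd ?inE//.
by apply: (ndh); exists d.
Qed.

(** * Almost inclusion and pseudo-intersections *)

Lemma finite_natP (A : set nat) :
  finite_set A <-> exists N, forall n, A n -> (n < N)%N.
Proof.
split=> [/finite_seqP[s ->]|[N AN]]; last exact: sub_finite_set (finite_II N).
by exists (\max_(i <- s) i).+1 => n /= ns; rewrite ltnS; exact: leq_bigmax_seq.
Qed.

Lemma infinite_natP (A : set nat) :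
  infinite_set A <-> forall N, exists2 n, (N <= n)%N & A n.
Proof.
rewrite finite_natP; split=> [nA N|AN [N NA]].
  apply: contrapT => nex; apply: nA; exists N => n An; rewrite ltnNge.
  by apply/negP => Nn; apply: nex; exists n.
by have [n Nn /NA] := AN N; rewrite ltnNge Nn.
Qed.

Lemma infinite_split {T : Type} (A B : set T) :
  infinite_set A -> infinite_set (A `&` B) \/ infinite_set (A `\` B).
Proof.
move=> infA; apply: contrapT => /not_orP[/contrapT fI /contrapT fD].
by apply: infA; rewrite -(setUIDK A B) finite_setU.
Qed.

Lemma finite_powerset_II n : finite_set [set q : set nat | q `<=` `I_n].
Proof.
pose f (A : {set 'I_n}) : set nat := [set k : nat | exists2 i : 'I_n, i \in A & k = i :> nat].
apply: (@sub_finite_set _ _ (range f)); last exact/finite_image/finite_finset.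
move=> q /= qn; exists [set i : 'I_n | `[< q i >]]%SET => //.
apply/seteqP; split => k /=; first by case=> i; rewrite finset.inE => /asboolP + ->.
by move=> qk; exists (Ordinal (qn _ qk)); rewrite ?finset.inE //; apply/asboolP.
Qed.

Definition almost_sub (x y : set nat) := finite_set (x `\` y).

Lemma almost_sub_trans x y z : almost_sub x y -> almost_sub y z -> almost_sub x z.
Proof.
move=> xy yz; apply: (@sub_finite_set _ _ ((x `\` y) `|` (y `\` z))).
  by move=> i [xi nzi]; have [yi|nyi] := pselect (y i); [right|left].
by rewrite finite_setU.
Qed.

Lemma sub_almost_sub x y : x `<=` y -> almost_sub x y.
Proof. by rewrite -setD_eq0 /almost_sub => ->; exact: finite_set0. Qed.

(** A finite nonempty part of the chain has a member [g] almost contained in all the others; only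
    finitely many points of [g] miss the intersection. *)
Lemma chain_sfip (F : set (set nat)) : (forall x, F x -> infinite_set x) ->
  (forall x y, F x -> F y -> almost_sub x y \/ almost_sub y x) -> sfip F.
Proof.
move=> Finf Fchain; split=> // G GF /finite_seqP[s Gs] [g0 Gg0].
rewrite {}Gs in GF Gg0 *.
have {Gg0} [g [gs gmin]] : exists g, g \in s /\
    forall y, y \in s -> almost_sub g y.
  case: s GF Gg0 => [//|g0' s] GF _.
  elim: s GF => [|a s IH] GF.
    exists g0'; split; first exact: mem_head.
    by move=> y; rewrite inE => /eqP ->; exact: sub_almost_sub.
  have [|g [gs gmin]] := IH.
    move=> y /= ys; apply: GF => /=; move: ys; rewrite !inE.
    by case/orP => [->//|->]; rewrite !orbT.
  have gs' : g \in [:: g0', a & s].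
    by move: gs; rewrite !inE => /orP[->//|->]; rewrite !orbT.
  have as' : a \in [:: g0', a & s] by rewrite !inE eqxx orbT.
  have [ga|ag] := Fchain g a (GF _ gs') (GF _ as').
    exists g; split => // y; rewrite !inE => /or3P[y0|/eqP->//|ys]; apply: gmin.
      by rewrite inE y0.
    by rewrite inE ys orbT.
  exists a; split => // y; rewrite !inE => /or3P[y0|/eqP->|ys].
  - by apply: almost_sub_trans ag (gmin _ _); rewrite inE y0.
  - exact: sub_almost_sub.
  - by apply: almost_sub_trans ag (gmin _ _); rewrite inE ys orbT.
have := Finf g (GF _ gs).
apply: contra_not => fin.
apply: (@sub_finite_set _ _ ((\bigcap_(A in [set` s]) A) `|`
    \bigcup_(y in [set` s]) (g `\` y))).
  move=> i gi; have [ai|/existsNP[y /not_implyP[ys nyi]]] :=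
    pselect (forall y, y \in s -> y i); first by left.
  by right; exists y.
rewrite finite_setU; split => //; apply: bigcup_finite; first exact: finite_seq.
exact: gmin.
Qed.

Lemma pseudo_intersection (F : set (set nat)) : p_eq_c ->
  ~ ([set: set nat] #<= F) -> sfip F -> has_pseudo_intersection F.
Proof. by move=> pc smallF sF; apply: contrapT => nF; exact/smallF/pc. Qed.

(** * Clopen sets of the Cantor space and the Galvin-Miller thinning *)

Definition word m (x : set nat) : seq bool := [seq `[< x i >] | i <- iota 0 m].

Lemma wordP m x y :
  word m x = word m y <-> forall i, (i < m)%N -> (x i <-> y i).
Proof.
rewrite /word; split=> [/eq_in_map xy i im|xy].
  have := xy i; rewrite mem_iota add0n im => /(_ isT) xyi.
  by split=> /asboolP; [rewrite xyi|rewrite -xyi] => /asboolP.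
apply/eq_in_map => i; rewrite mem_iota add0n => /= im.
exact: asbool_equiv_eq (xy i im).
Qed.

(* The component [r] of the code [(r, m, w)] is ignored: it makes every clopen
   subset of the Cantor space have infinitely many codes. *)
Definition clopen_of_code n : set (set nat) :=
  match unpickle n with
  | Some (r, m, w) => let _ : nat := r in [set x | word m x \in (w : seq (seq bool))]
  | None => set0
  end.

Lemma clopen_of_code_word n :
  exists m, forall x y, word m x = word m y ->
    clopen_of_code n x -> clopen_of_code n y.
Proof.
rewrite /clopen_of_code; case: (unpickle n) => [[[r m] w]|]; last by exists 0%N.
by exists m => x y /= <-.
Qed.

Lemma infinite_clopen_codes m (G : set (set nat)) : finite_set G ->
  infinite_set [set n | clopen_of_code n =
                        [set x | exists2 g, G g & word m x = word m g]].
Proof.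
move=> /finite_seqP[s ->].
pose code r := pickle (r : nat, m, [seq word m g | g <- s]).
have codeinj : injective code by move=> r r' /(pcan_inj pickleK)[].
apply: (@sub_infinite_set _ (range code)).
  move=> _ [r _ <-]; apply/seteqP; rewrite /clopen_of_code pickleK /=.
  split=> x /=; first by case/mapP => g gs xg; exists g.
  by case=> g gs ->; exact: map_f.
by move=> /(finite_preimage (in2W codeinj))/= fin; apply: infinite_nat;
  apply: sub_finite_set fin => r _; exists r.
Qed.

(** For all large [j] in [J] the clopen set coded by [j] contains every subset of {0,...,m-1}. It
    depends only on coordinates below some [M], so it contains every [x] without elements in [m, M).
    Iteration gives the intervals. *)
Lemma galvin_miller (J : set nat) : infinite_set J ->
  (forall q, finite_set q -> finite_set [set j | J j /\ ~ clopen_of_code j q]) ->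
  exists n j : nat -> nat, n 0%N = 0%N /\ forall k, [/\ (n k <= j k < n k.+1)%N, J (j k) &
    forall x : set nat, (forall i, (n k <= i < n k.+1)%N -> ~ x i) ->
      clopen_of_code (j k) x].
Proof.
move=> infJ Jfin.
have /choice[g gP] m : exists p : nat * nat, [/\ (m <= p.1 < p.2)%N, J p.1 &
    forall x : set nat, (forall i, (m <= i < p.2)%N -> ~ x i) ->
      clopen_of_code p.1 x].
  pose B := \bigcup_(q in [set q | q `<=` `I_m]) [set j | J j /\ ~ clopen_of_code j q].
  have /infinite_natP/(_ m)[j mj [Jj nBj]] : infinite_set (J `\` B).
    apply: infinite_setD => //; apply: bigcup_finite; first exact: finite_powerset_II.
    by move=> q qm; apply: Jfin; apply: sub_finite_set qm (finite_II m).
  have [M jM] := clopen_of_code_word j.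
  (* Ending the interval beyond [j] as well makes the [j k] strictly increasing. *)
  exists (j, maxn j.+1 M); split=> //=; first by lia.
  move=> x xmiss; apply: (jM (x `&` `I_m)).
    apply/wordP => i iM; split=> [[]//|xi]; split=> //=.
    by rewrite ltnNge; apply/negP => mi; apply: (xmiss i) => //; lia.
  by apply: contrapT => nc; apply: nBj; exists (x `&` `I_m) => //= i [].
pose n k := iter k (fun m => (g m).2) 0%N.
by exists n, (fun k => (g (n k)).1); split=> // k; exact: (gP (n k)).
Qed.

(* Passing to the part of [x] lying in the intervals of one parity makes it
   miss all the intervals of the other parity. *)
Lemma thin_gamma (J x : set nat) : infinite_set J -> infinite_set x ->
  (forall q, finite_set q -> finite_set [set j | J j /\ ~ clopen_of_code j q]) ->
  exists x' J', [/\ x' `<=` x, infinite_set x', J' `<=` J, infinite_set J' &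
    forall y, almost_sub y x' -> finite_set [set j | J' j /\ ~ clopen_of_code j y]].
Proof.
move=> infJ infx /(galvin_miller infJ)[n [j [n0 njP]]].
have nlt k : (n k < n k.+1)%N by have [] := njP k; lia.
have nmono k l : (k <= l)%N -> (n k <= n l)%N.
  by move=> /subnK <-; elim: (l - k)%N => //= d; rewrite addSn; have := nlt (d + k)%N; lia.
have kn k : (k <= n k)%N by elim: k => // k; have := nlt k; lia.
have kj k : (k <= j k)%N by have [] := njP k; have := kn k; lia.
pose block b : set nat := [set i | exists k, odd k = b /\ (n k <= i < n k.+1)%N].
have miss b z : z `<=` block b -> forall k i, odd k = ~~ b ->
    (n k <= i < n k.+1)%N -> ~ z i.
  move=> zb k i kb ki /zb[l [lb li]].
  have [kl|lk|kl] := ltngtP k l.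
  - by have := nmono _ _ kl; lia.
  - by have := nmono _ _ lk; lia.
  - by move: kb; rewrite kl lb; case: b {lb zb}.
have main b : infinite_set (x `&` block b) -> exists x' J',
    [/\ x' `<=` x, infinite_set x', J' `<=` J, infinite_set J' &
    forall y, almost_sub y x' -> finite_set [set j | J' j /\ ~ clopen_of_code j y]].
  move=> infb; exists (x `&` block b), [set j k | k in [set k | odd k = ~~ b]].
  split=> //.
  - by move=> _ [k _ <-]; have [] := njP k.
  - apply/infinite_natP => N; exists (j (N.*2 + ~~ b)%N).
      by apply: leq_trans (kj _); lia.
    by exists (N.*2 + ~~ b)%N => //=; rewrite oddD odd_double addFb oddb.
  (* From [N] on, [y] stays in the blocks of parity [b]; an interval of the other parity with
     [k >= N] starts at [n k >= N], so [y] misses it. *)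
  move=> y /finite_natP[N yN]; apply: (@sub_finite_set _ _ (j @` `I_N)).
    move=> _ [[k kb <-] nc]; exists k => //=; rewrite ltnNge; apply/negP => Nk.
    apply: nc; have [_ _] := njP k; apply => i ki yi.
    have /yN : (y `\` (x `&` block b)) i.
      by split=> // -[_ bi]; apply: (@miss b (block b) _ k i).
    by have := kn k; lia.
  exact/finite_image/finite_II.
have [infb|infb] := infinite_split (block true) infx; first exact: main infb.
apply: (main false); apply: sub_infinite_set infb => i [xi nbi]; split=> //.
have [k ki] : exists k, (n k <= i < n k.+1)%N.
  have ex : exists k, (i < n k.+1)%N by exists i; have := kn i.+1; lia.
  case: (ex_minnP ex) => -[|k] ik min; first by exists 0%N; rewrite ik n0.
  exists k.+1; rewrite ik andbT leqNgt; apply/negP => /min; lia.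
by exists k; split=> //; apply/negbTE/negP => ko; apply: nbi; exists k.
Qed.

(** * Construction of the tower *)

(* The third clause makes the tower generate an ultrafilter; the fourth makes it
   separate any two numbers, so that [n |-> {x : n in x}] is injective on it. *)
Definition stage_prop (F : set (set nat)) (S x : set nat) : Prop :=
  [/\ infinite_set x, forall y, F y -> almost_sub x y,
      almost_sub x S \/ almost_sub x (~` S),
      finite_set S -> forall k i, S k -> (i <= k)%N -> (x i <-> S i) &
      (forall G, finite_set G -> G `<=` F `|` finite_set ->
         infinite_set [set n | S n /\ forall g, G g -> clopen_of_code n g]) ->
      exists J, [/\ J `<=` S, infinite_set J & forall y, F y \/ almost_sub y x ->
         finite_set [set j | J j /\ ~ clopen_of_code j y]]].

Lemma finite_sub_image {T U : Type} (f : T -> U) (Y : set T) (G : set U) :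
  finite_set G -> G `<=` f @` Y ->
  exists H, [/\ finite_set H, H `<=` Y & G `<=` f @` H].
Proof.
move=> finG GY; have [[t0 Yt0]|Y0] := pselect (exists t, Y t); last first.
  by exists set0; split=> // u /GY[t Yt _]; case: Y0; exists t.
have /choice[c cP] u : exists t, Y t /\ (G u -> f t = u).
  by have [/GY[t Yt <-]|nGu] := pselect (G u); [exists t|exists t0].
exists (c @` G); split; first exact: finite_image.
  by move=> _ [u _ <-]; have [] := cP u.
by move=> u Gu; have [_ /(_ Gu) fc] := cP u; exists (c u) => //; exists u.
Qed.

Lemma countable_finite_sets : countable (finite_set : set (set nat)).
Proof.
apply: (@sub_countable _ _ _ [set A : set nat | A `<=` setT /\ finite_set A]).
  by apply: subset_card_le => A.
exact/countable_finite_subset/countableP.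
Qed.

(** By the omega condition the code sets [B y], for [y] in [F] or finite, have infinite finite
    intersections. There are fewer than c of them, so p = c yields a subsequence good for all these
    [y]; [thin_gamma] extends this to every [y] almost contained in a thinner [x']. *)
Lemma stage_gamma (F : set (set nat)) (S x : set nat) : p_eq_c ->
  ~ ([set: set nat] #<= F) -> infinite_set x ->
  (forall G, finite_set G -> G `<=` F `|` finite_set ->
    infinite_set [set n | S n /\ forall g, G g -> clopen_of_code n g]) ->
  exists x' J, [/\ x' `<=` x, infinite_set x', J `<=` S, infinite_set J &
    forall y, F y \/ almost_sub y x' ->
      finite_set [set j | J j /\ ~ clopen_of_code j y]].
Proof.
move=> pc smallF infx omegaS.
pose B (y : set nat) := [set n | S n /\ clopen_of_code n y].
have finG0 G : finite_set G -> G `<=` B @` (F `|` finite_set) ->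
    infinite_set (\bigcap_(A in G) A).
  move=> finG /(finite_sub_image finG)[H [finH HY GH]].
  apply: sub_infinite_set (omegaS H finH HY) => n [Sn nH] _ /GH[y Hy <-].
  by split => //; exact: nH.
have [J [infJ JB]] : has_pseudo_intersection (B @` (F `|` finite_set)).
  apply: pseudo_intersection => //.
    move=> /card_le_trans/(_ (card_image_le _ _)).
    move=> /card_le_setU_countable h; apply/smallF/h.
    exact: countable_finite_sets.
  split=> [A BA|G GB finG _]; last exact: finG0.
  have := finG0 [set A] (finite_set1 A); rewrite bigcap_set1; apply.
  by move=> _ ->.
have JS : infinite_set (J `&` S).
  move=> fin; apply: infJ.
  (* The pseudo-intersection may leave [S], but it is almost contained in [B set0], a subset of
     [S]. *)
  have : finite_set (J `\` B set0) by apply: JB; exists set0 => //; right; exact: finite_set0.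
  move=> finB; apply: (@sub_finite_set _ _ ((J `&` S) `|` (J `\` B set0))).
    move=> i Ji; have [Si|nSi] := pselect (S i); first by left.
    by right; split => // -[].
  by rewrite finite_setU.
have Jgamma y : (F `|` finite_set) y ->
    finite_set [set j | (J `&` S) j /\ ~ clopen_of_code j y].
  move=> Yy; have := JB (B y) (imageP B Yy); apply: sub_finite_set.
  by move=> j [[Jj Sj] nj]; split => // -[].
have [x' [J' [x'x infx' J'J infJ' J'g]]] :=
  thin_gamma JS infx (fun q fq => Jgamma q (or_intror fq)).
exists x', J'; split=> //; first by move=> j /J'J[].
move=> y [Fy|/J'g//].
by apply: sub_finite_set (Jgamma y (or_introl Fy)) => j [/J'J].
Qed.

(** A pseudo-intersection of [F] is thinned first for the cover, then to decide [S]; both gains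
    survive the final finite change, which secures the fourth clause. *)
Lemma stage_exists (F : set (set nat)) (S : set nat) : p_eq_c ->
  ~ ([set: set nat] #<= F) -> (forall x, F x -> infinite_set x) ->
  (forall x y, F x -> F y -> almost_sub x y \/ almost_sub y x) ->
  exists x, stage_prop F S x.
Proof.
move=> pc smallF Finf Fchain.
have [a [infa aF]] := pseudo_intersection pc smallF (chain_sfip Finf Fchain).
have [a1 [a1a inf1 Sgamma]] : exists a1, [/\ a1 `<=` a, infinite_set a1 &
    (forall G, finite_set G -> G `<=` F `|` finite_set ->
      infinite_set [set n | S n /\ forall g, G g -> clopen_of_code n g]) ->
    exists J, [/\ J `<=` S, infinite_set J & forall y, F y \/ almost_sub y a1 ->
       finite_set [set j | J j /\ ~ clopen_of_code j y]]].
  have [om|nom] := pselect (forall G, finite_set G -> G `<=` F `|` finite_set ->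
      infinite_set [set n | S n /\ forall g, G g -> clopen_of_code n g]).
    have [x [J [xa infx JS infJ Jg]]] := stage_gamma pc smallF infa om.
    by exists x; split=> // _; exists J.
  by exists a; split=> // om; case: nom.
have [a2 [a21 inf2 a2S]] : exists a2, [/\ a2 `<=` a1, infinite_set a2 &
    almost_sub a2 S \/ almost_sub a2 (~` S)].
  have [inf2|inf2] := infinite_split S inf1.
    by exists (a1 `&` S); split=> //; left; apply: sub_almost_sub => i [].
  by exists (a1 `\` S); split=> //; right; apply: sub_almost_sub => i [].
have [N NP] : exists N, finite_set S -> forall n, S n -> (n < N)%N.
  have [/finite_natP[N NS]|nS] := pselect (finite_set S); first by exists N.
  by exists 0%N.
(* A finite [S] lies below [N], where [x] copies it. *)
pose x := (S `&` `I_N) `|` (a2 `\` `I_N).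
have xa2 : almost_sub x a2.
  by apply: sub_finite_set (finite_II N) => i [[[Si iN] _//|[ai _] /(_ ai)]].
exists x; split.
- apply: (@sub_infinite_set _ (a2 `\` `I_N)); first by move=> i; right.
  by apply: infinite_setD => //; exact: finite_II.
- move=> y Fy; apply: almost_sub_trans xa2 _; apply: almost_sub_trans (aF y Fy).
  by apply: sub_almost_sub => i /a21/a1a.
- by case: a2S => ?; [left|right]; exact: almost_sub_trans xa2 _.
- move=> finS k i Sk ik; have iN : (i < N)%N := leq_ltn_trans ik (NP finS k Sk).
  split=> [[[//]|[_ /(_ iN)]//]|Si]; left; split=> //.
- move=> /Sgamma[J [JS infJ Jg]]; exists J; split=> // y Fxy; apply: Jg.
  case: Fxy => [|yx]; [by left|right].
  by apply: almost_sub_trans yx (almost_sub_trans xa2 (sub_almost_sub a21)).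
Qed.

(** One enumeration [e] serves all tasks: [e t] is at once a set to decide, a set to copy if finite,
    and a set of codes. By induction the earlier values form a chain of infinite sets, so a next
    value exists. *)
Lemma tower_exists : p_eq_c -> exists (I : Type) (x : I -> set nat) (e : I -> set nat)
    (lt : I -> I -> Prop),
  [/\ forall s t, s = t \/ lt s t \/ lt t s, forall S, exists t, e t = S &
      forall t, stage_prop (x @` [set s | lt s t]) (e t) (x t)].
Proof.
move=> pc; have [I [lt [e [wf tot short esurj]]]] := short_well_order.
have [x xP] := wf_choice (fun t F => stage_prop F (e t)) set0 wf.
exists I, x, e, lt; split=> // t; elim/(well_founded_ind wf) : t => t IH.
apply: xP; apply: stage_exists => //.
- by move=> /card_le_trans/(_ (card_image_le _ _)); exact: short.
- by move=> _ [s st <-]; have [] := IH s st.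
- move=> _ _ [s st <-] [u ut <-]; have [<-|[su|us]] := tot s u.
  + by left; exact: sub_almost_sub.
  + by right; have [_ h _ _ _] := IH u ut; apply: h; exists s.
  + by left; have [_ h _ _ _] := IH s st; apply: h; exists u.
Qed.

(** * Embedding the Cantor space into the reals *)

Section Embedding.
Import Order.TTheory GRing.Theory Num.Theory.
Local Open Scope ring_scope.
Variable R : realType.
Implicit Types x y : set nat.

(* Base 4 with digits 0 and 1: the tail [sum_(i > n) 4^-i = 4^-n / 3] is smaller
   than the digit [4^-n], so the expansion is injective with explicit gaps. *)
Let w n : R := 4^-1 ^+ n.

Let w_gt0 n : 0 < w n. Proof. by rewrite exprn_gt0. Qed.

Let wS n : w n.+1 = w n / 4. Proof. by rewrite /w exprSr. Qed.

Let w_le m n : (m <= n)%N -> w n <= w m.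
Proof. by move=> mn; rewrite /w ler_wiXn2l //; lra. Qed.

Definition digit_sum x n : R := \sum_(i < n) (`[< x i >]%:R * w i).

(** As the partial sums are nondecreasing, this is the sum of the series of 4^-i over [i] in [x]. *)
Definition cantor_embedding x : R := sup (range (digit_sum x)).

Let digit_sumS x n : digit_sum x n.+1 = digit_sum x n + `[< x n >]%:R * w n.
Proof. by rewrite /digit_sum big_ord_recr. Qed.

(** [4 / 3 * (w n - w (k + n))] is the geometric sum of [w i] for [n <= i < k + n], the growth when
    all these digits are 1. *)
Let digit_sum_le x n k :
  digit_sum x n <= digit_sum x (k + n) <= digit_sum x n + 4 / 3 * (w n - w (k + n)).
Proof.
elim: k => [|k /andP[IH1 IH2]]; first by rewrite add0n subrr mulr0 addr0 lexx.
rewrite addSn digit_sumS wS; have := w_gt0 (k + n).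
by case: `[< x (k + n)%N >] => /= ?; lra.
Qed.

Let digit_sum_ub x n m : digit_sum x m <= digit_sum x n + 4 / 3 * w n.
Proof.
have [mn|/ltnW nm] := leqP m n.
  have := digit_sum_le x m (n - m); rewrite subnK // => /andP[h _].
  by have := w_gt0 n; lra.
have := digit_sum_le x n (m - n); rewrite subnK // => /andP[_ h].
by have := w_gt0 m; lra.
Qed.

Let embedding_bounds x n : digit_sum x n <= cantor_embedding x <= digit_sum x n + 4 / 3 * w n.
Proof.
have ub : ubound (range (digit_sum x)) (digit_sum x n + 4 / 3 * w n).
  by move=> _ [m _ <-]; exact: digit_sum_ub.
apply/andP; split; last by apply: ge_sup => //; exists (digit_sum x 0); exists 0%N.
apply: sup_upper_bound; last by exists n.
by split; [exists (digit_sum x 0); exists 0%N|exists (digit_sum x n + 4 / 3 * w n)].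
Qed.

Let digit_sum_word x y n : word n x = word n y -> digit_sum x n = digit_sum y n.
Proof.
move=> /wordP xy; apply: eq_bigr => i _; congr (_%:R * _).
by congr nat_of_bool; exact: asbool_equiv_eq (xy _ (ltn_ord i)).
Qed.

Let embedding_close x y n :
  word n x = word n y -> `|cantor_embedding x - cantor_embedding y| <= 4 / 3 * w n.
Proof.
move=> /digit_sum_word xy; have := embedding_bounds x n.
have := embedding_bounds y n; rewrite xy => /andP[? ?] /andP[? ?].
by rewrite ler_norml; apply/andP; split; lra.
Qed.

(** The digit at [n] gains [w n], and the later digits of [y] recover at most
    [4 / 3 * w n.+1 = w n / 3]. *)
Let embedding_gap x y n : word n x = word n y -> x n -> ~ y n ->
  2 / 3 * w n <= cantor_embedding x - cantor_embedding y.
Proof.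
move=> /digit_sum_word xy xn yn.
have /andP[+ _] := embedding_bounds x n.+1; have /andP[_] := embedding_bounds y n.+1.
rewrite !digit_sumS xy wS (asboolT xn) (asboolF yn) /=; lra.
Qed.

(** A first difference at [j <= n] would force a gap of at least [2 / 3 * w j >= 2 / 3 * w n]. *)
Lemma embedding_word x y n : `|cantor_embedding x - cantor_embedding y| < 2 / 3 * w n ->
  word n.+1 x = word n.+1 y.
Proof.
move=> close; apply/wordP => i; rewrite ltnS => i_n; apply: contrapT => xyi.
have ex : exists j, `[< ~ (x j <-> y j) >] by exists i; apply/asboolP.
case: (ex_minnP ex) => j /asboolP xyj jmin.
have jn : (j <= n)%N by apply: leq_trans (jmin _ _) i_n; apply/asboolP.
have word_xy : word j x = word j y.
  apply/wordP => l lj; apply: contrapT => xyl.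
  by have /asboolP/jmin := xyl; rewrite leqNgt lj.
have := w_le jn; have [xj|xj] := pselect (x j); have [yj|yj] := pselect (y j).
- by case: xyj.
- have := embedding_gap word_xy xj yj; move: close; rewrite ltr_norml => /andP[]; lra.
- have := embedding_gap (esym word_xy) yj xj; move: close; rewrite ltr_norml => /andP[]; lra.
- by case: xyj.
Qed.

Lemma embedding_inj : injective cantor_embedding.
Proof.
move=> x y xy; apply/seteqP.
suff h n : x n <-> y n by split=> n /h.
have : word n.+1 x = word n.+1 y.
  by apply: embedding_word; rewrite xy subrr normr0; have := w_gt0 n; lra.
by move/wordP; apply.
Qed.

Lemma embedding_continuous (V : set R) x : open V -> V (cantor_embedding x) ->
  exists m, forall y, word m y = word m x -> V (cantor_embedding y).
Proof.
move=> oV Vx; have /nbhs_ballP[e /= e0 eV] := open_nbhs_nbhs (conj oV Vx).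
have [m wm] : exists m, w m < e / 2.
  have w0 : w n @[n --> \oo] --> (0 : R).
    by apply: cvg_expr; rewrite gtr0_norm; lra.
  have e2 : 0 < e / 2 by lra.
  have /cvgrPdist_lt/(_ _ e2)[m _ mP] := w0.
  by exists m; have := mP m (leqnn m); rewrite /= sub0r normrN gtr0_norm // w_gt0.
exists m => y /embedding_close yx; apply: eV.
by rewrite /ball /= distrC; lra.
Qed.

(** Image points within [2 / 3 * w m] of each other come from sets with the same word, so balls of
    this radius around the images of [P] catch no other image points. *)
Lemma embedding_open m (P : set (set nat)) :
  (forall x y, word m x = word m y -> P x -> P y) ->
  exists V : set R, open V /\ forall x, V (cantor_embedding x) <-> P x.
Proof.
move=> mP; exists (\bigcup_(x in P) ball (cantor_embedding x) (2 / 3 * w m)); split.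
  by apply: bigcup_open => x _; apply: ball_open; have := w_gt0 m; lra.
move=> y; split=> [[x Px /embedding_word]|Py]; last first.
  by exists y => //; apply: ballxx; have := w_gt0 m; lra.
move=> /wordP xy; apply: mP Px; apply/wordP => i im; apply: xy; exact: ltnW.
Qed.

End Embedding.

(** * Ultrafilter towers and their size *)

Definition ultra_tower (T : set (set nat)) : Prop :=
  [/\ forall y, T y -> infinite_set y,
      forall y z, T y -> T z -> almost_sub y z \/ almost_sub z y,
      forall S, exists2 y, T y & almost_sub y S \/ almost_sub y (~` S) &
      forall n m, n <> m -> exists2 y, T y & y n /\ ~ y m].

(** This is binom(Omega, Gamma) at the level of clopen sets; infinity and finiteness count codes, so
    a clopen set may recur. *)
Definition gamma_like (Y : set (set nat)) : Prop :=
  forall S : set nat,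
    (forall G, finite_set G -> G `<=` Y ->
      infinite_set [set n | S n /\ forall g, G g -> clopen_of_code n g]) ->
    exists J, [/\ J `<=` S, infinite_set J &
      forall y, Y y -> finite_set [set j | J j /\ ~ clopen_of_code j y]].

Lemma ultra_tower_exists : p_eq_c ->
  exists T, ultra_tower T /\ gamma_like (T `|` finite_set).
Proof.
move=> /tower_exists[I [x [e [lt [tot esurj xP]]]]]; exists (range x); split.
  split.
  - by move=> _ [t _ <-]; have [] := xP t.
  - move=> _ _ [s _ <-] [t _ <-]; have [->|[st|ts]] := tot s t.
    + by left; exact: sub_almost_sub.
    + by right; have [_ h _ _ _] := xP t; apply: h; exists s.
    + by left; have [_ h _ _ _] := xP s; apply: h; exists t.
  - by move=> S; have [t <-] := esurj S; exists (x t); [exists t|have [] := xP t].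
  (* Including [m.+1] forces [x t] to agree with this set at [m] even when [m > n]; [m] itself is
     not in the set. *)
  - move=> n m nm; have [t et] := esurj [set n; m.+1]; exists (x t); first by exists t.
    have [_ _ _ + _] := xP t; rewrite et => /(_ (finite_set2 _ _)) h; split.
      by apply/(h n n (or_introl erefl) (leqnn n)); left.
    by move/(h m.+1 m (or_intror erefl) (leqnSn m)) => [/esym//|/n_Sn].
move=> S; have [t <-] := esurj S; have [_ xlt _ _ xg] := xP t => omega.
have [|J [JS infJ Jg]] := xg.
  move=> G finG GF; apply: omega => // g /GF[[s _ <-]|]; [left|by right].
  by exists s.
(* Besides the earlier members, [x t], the later members and the finite sets are all almost
   contained in [x t]. *)
exists J; split=> // y [[s _ <-]|finy]; apply: Jg; last first.
  by right; apply: sub_finite_set finy => i [].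
have [->|[st|ts]] := tot s t.
- by right; exact: sub_almost_sub.
- by left; exists s.
- by right; have [_ h _ _ _] := xP s; apply: h; exists t.
Qed.

Lemma infinite_image {T U : Type} (f : T -> U) (A : set T) :
  injective f -> infinite_set A -> infinite_set (f @` A).
Proof.
move=> finj infA [n]; rewrite (card_eql (inj_card_eq (in2W finj))) => An.
by apply: infA; exists n.
Qed.

Lemma infinite_halves {T : Type} (A : set T) : infinite_set A ->
  exists B, infinite_set (A `&` B) /\ infinite_set (A `\` B).
Proof.
elim/Ppointed: T => T in A *; first by rewrite emptyE => /(_ (finite_set0 _)).
move=> /infiniteP/pcard_leP[g].
have ginj : injective g by move=> i j; apply: inj; rewrite inE.
have inf b : infinite_set [set n | odd n = b].
  apply/infinite_natP => N; exists (N.*2 + b)%N; first by lia.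
  by rewrite /= oddD odd_double oddb.
exists (g @` [set n | odd n = true]); split.
  apply: sub_infinite_set (infinite_image ginj (inf true)) => _ [n no <-].
  by split; [exact: funS|exists n].
apply: sub_infinite_set (infinite_image ginj (inf false)) => _ [n no <-].
by split; [exact: funS|move=> [m mo /ginj mn]; move: mo; rewrite mn /= no].
Qed.

(** A pseudo-intersection would split into two infinite halves, but a member of [T] deciding one
    half makes one of the two finite. So [T] has none, and p = c applies. *)
Lemma ultra_tower_card T : p_eq_c -> ultra_tower T -> [set: set nat] #<= T.
Proof.
move=> pc [Tinf Tchain Tultra _]; apply: pc; first exact: chain_sfip.
move=> [a [infa aT]]; have [S [infI infD]] := infinite_halves infa.
have [y Ty [yS|yS]] := Tultra S.
  apply: infD; apply: sub_finite_set (almost_sub_trans (aT y Ty) yS).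
  by move=> i [].
apply: infI; apply: sub_finite_set (almost_sub_trans (aT y Ty) yS).
by move=> i [ai Si]; split=> // /(_ Si).
Qed.

Lemma infinite_fiber {T U : Type} (f : T -> U) (A : set T) :
  infinite_set A -> finite_set (f @` A) -> exists2 u, (f @` A) u &
    infinite_set (A `&` f @^-1` [set u]).
Proof.
move=> infA fin; apply: contrapT => nex; apply: infA.
apply: (@sub_finite_set _ _ (\bigcup_(u in f @` A) (A `&` f @^-1` [set u]))).
  by move=> t At; exists (f t) => //; exists t.
apply: bigcup_finite => // u fAu; apply: contrapT => inf.
by apply: nex; exists u.
Qed.

Lemma infinite_cofinite_mem {T : Type} (A : set T) (P : T -> Prop) :
  infinite_set A -> finite_set [set t | A t /\ ~ P t] -> exists2 t, A t & P t.
Proof.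
move=> infA fin; apply: contrapT => nex; apply: infA; apply: sub_finite_set fin.
by move=> t At; split=> // Pt; apply: nex; exists t.
Qed.

(** * The covering properties of the images in the reals *)

Lemma gamma_like_binom (R : realType) (Y : set (set nat)) : gamma_like Y ->
  sel_binom (@OmegaO R) (@GammaO R) (@cantor_embedding R @` Y).
Proof.
set f := @cantor_embedding R; set X := f @` Y.
move=> Ygamma U [[[Uproper _] Uomega] Uopen].
(* The open cover is replaced by the codes of clopen sets whose trace on [Y] lies in one of its
   members. A finite set inside a member has a clopen neighbourhood there, with infinitely many
   codes. *)
pose S := [set n | exists2 u, U u & forall y, Y y -> clopen_of_code n y -> u (f y)].
have [|J [JS infJ Jg]] := Ygamma S.
  move=> G finG GY.
  have [|u [Uu Gu]] := Uomega (f @` G) (finite_image f finG).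
    by move=> _ [g Gg <-]; exists g => //; exact: GY.
  have [V [oV uE]] := Uopen u Uu.
  have /choice[M MP] g : exists m, G g ->
      forall y, word m y = word m g -> V (f y).
    have [Gg|nGg] := pselect (G g); last by exists 0%N.
    have : u (f g) by apply: Gu; exists g.
    by rewrite uE => -[/(embedding_continuous oV)[m mP] _]; exists m.
  have /finite_natP[m mM] := finite_image M finG.
  have Vword y g : G g -> word m y = word m g -> V (f y).
    move=> Gg /wordP yg; apply: (MP g Gg); apply/wordP => i iM; apply: yg.
    by apply: ltn_trans iM (mM _ _); exists g.
  apply: sub_infinite_set (@infinite_clopen_codes m _ finG) => n /= nE.
  split; last by move=> g Gg; rewrite nE; exists g.
  exists u => // y Yy; rewrite nE uE => -[g Gg /(Vword y g Gg) Vy].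
  by split=> //; exists y.
have /choice[u uP] j : exists u, J j ->
    U u /\ forall y, Y y -> clopen_of_code j y -> u (f y).
  by have [/JS[u]|nJ] := pselect (J j); [exists u|exists set0].
have uU j : J j -> U (u j) by case/uP.
have uY j y : J j -> Y y -> clopen_of_code j y -> u j (f y).
  by case/uP => _; exact.
exists (u @` J); split; first by move=> _ [j /uU ? <-].
split; last by move=> _ [j /uU/Uopen ? <-].
split; [split|split].
- by move=> _ [j /uU/Uproper ? <-].
- apply/seteqP; split=> [z [_ [j /uU/Uproper[uX _] <-]]|_ [y Yy <-]]; first exact: uX.
  have [j Jj yj] := infinite_cofinite_mem infJ (Jg y Yy).
  by exists (u j); [exists j|exact: uY].
(* If finitely many members were chosen, one of them would serve infinitely many codes; every [y]
   lies in one of the sets so coded, so this member would be all of [X]. *)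
- move=> /(infinite_fiber infJ)[_ [j0 Jj0 <-] inff].
  have [_] := Uproper _ (uU j0 Jj0); apply=> _ [y Yy <-].
  have [|j [Jj <-] yj] := @infinite_cofinite_mem _ _ (clopen_of_code^~ y) inff.
    by apply: sub_finite_set (Jg y Yy) => j [[]].
  exact: uY.
- move=> _ [y Yy <-]; apply: (@sub_finite_set _ _ (u @` [set j | J j /\ ~ clopen_of_code j y])).
    move=> _ [[j Jj <-] nuy]; exists j => //; split=> // yj; apply: nuy; exact: uY.
  exact/finite_image/Jg.
Qed.

Lemma ultra_tower_not_split (R : realType) (T : set (set nat)) : ultra_tower T ->
  ~ sel_split (@CT R) (@CT R) (@cantor_embedding R @` T).
Proof.
set f := @cantor_embedding R; set Z := f @` T.
move=> [Tinf Tchain Tultra Tsep].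
have finj : injective f := @embedding_inj R.
pose c n := f @` [set y | T y /\ y n].
have cE n y : c n (f y) <-> T y /\ y n.
  by split=> [[z zP /finj <-]//|yP]; exists y.
have cinj : injective c.
  move=> n m nm; apply: contrapT => /Tsep[y Ty [yn nym]].
  by have : c n (f y) by [apply/cE]; rewrite nm => /cE[].
(* Key to the tau condition: only the [c n] with [n] in [y] but not in [z] separate [f y] from [f z]
   in this direction. *)
have cfin y z : T z -> almost_sub y z ->
    finite_set [set u | range c u /\ u (f y) /\ ~ u (f z)].
  move=> Tz yz; apply: (@sub_finite_set _ _ (c @` (y `\` z))); last exact: finite_image.
  move=> _ [[n _ <-] [/cE[Ty yn] nz]].
  by exists n => //; split=> // zn; apply: nz; apply/cE.
have cCT : CT Z (range c).
  split; [split; [split|split]|split].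
  - move=> _ [n _ <-]; split; first by move=> _ [y [Ty _] <-]; exists y.
    have [y Ty [_ nyn]] := Tsep n.+1 n (@nesym _ _ _ (n_Sn n)).
    by move=> /(_ (f y)) Zc; have /cE[] : c n (f y) by apply: Zc; exists y.
  - apply/seteqP; split=> [_ [_ [n _ <-] [y [Ty _] <-]]|_ [y Ty <-]]; first by exists y.
    have [n yn] := infinite_setN0 (Tinf y Ty).
    by exists (c n); [exists n|apply/cE].
  - move=> _ [y Ty <-]; apply: sub_infinite_set (infinite_image cinj (Tinf y Ty)).
    by move=> _ [n yn <-]; split; [exists n|apply/cE].
  - move=> _ _ [y Ty <-] [z Tz <-].
    by have [yz|zy] := Tchain y z Ty Tz; [left|right]; exact: cfin.
  - exact: card_le_trans (card_image_le _ _) (countableP _).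
  - move=> _ [n _ <-]; pose P b (y : set nat) := `[< y n >] = b.
    have Pword b x y : word n.+1 x = word n.+1 y -> P b x -> P b y.
      move=> /wordP/(_ n (ltnSn n)) xy <-; rewrite /P.
      by apply/esym; exact: asbool_equiv_eq.
    have [V [oV VP]] := embedding_open R (Pword true).
    have [W [oW WP]] := embedding_open R (Pword false).
    split.
      exists V; split=> //; apply/seteqP; split=> [_ [y [Ty yn] <-]|z [Vy [y Ty yE]]].
        by split; [apply/VP/asboolP|exists y].
      by move: Vy; rewrite -yE => /VP/asboolP yn; exists y.
    exists (~` W); split; first exact: open_closedC.
    apply/seteqP; split=> [_ [y [Ty yn] <-]|z [Wy [y Ty yE]]].
      by split; [move=> /WP/asboolP|exists y].
    exists y => //; split=> //; apply: contrapT => nyn; apply: Wy.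
    by rewrite -yE; apply/WP/asboolP.
move=> /(_ _ cCT)[V [W [VWc [VW0 [[V' [V'V [[_ [V'inf _]] _]]] [W' [W'W [[_ [W'inf _]] _]]]]]]]].
have inc u : V u \/ W u -> exists n, u = c n.
  by move=> VWu; have : range c u; [rewrite -VWc|case=> n _ <-; exists n].
(* A [y] deciding the indices of [V] leaves [f y] in only finitely many members of [W] or of [V], so
   [W'] or [V'] is no tau-cover. *)
have [y Ty [yV|yW]] := Tultra [set n | V (c n)].
  apply: (W'inf (f y)); first by exists y.
  apply: sub_finite_set (finite_image c yV) => u [W'u uy].
  have Wu := W'W u W'u; have [n un] := inc u (or_intror Wu).
  move: uy; rewrite un => /cE[_ yn]; exists n => //; split=> // /= Vn.
  by have : (V `&` W) (c n) by [rewrite -un in Vn *]; rewrite VW0.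
apply: (V'inf (f y)); first by exists y.
apply: sub_finite_set (finite_image c yW) => u [V'u uy].
have Vu := V'V u V'u; have [n un] := inc u (or_introl Vu).
by move: uy; rewrite un => /cE[_ yn]; exists n => //; split=> //=; apply; rewrite -un.
Qed.

(** * The space and its countable subset *)

Theorem theorem7p2 (R : realType) :
  p_eq_c ->
  exists (X Q : set R),
    X #= [set: set nat] /\ Q `<=` X /\ countable Q /\
    sel_binom (@OmegaO R) (@GammaO R) X /\
    ~ sel_split (@CT R) (@CT R) (X `\` Q).
Proof.
move=> pc; have [T [towT gamT]] := ultra_tower_exists pc.
pose f := @cantor_embedding R; have finj : injective f := @embedding_inj R.
exists (f @` (T `|` finite_set)), (f @` finite_set).
split.
  rewrite card_eq_le; apply/andP; split.
    by apply: card_le_trans (card_image_le _ _) _; exact: subset_card_le.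
  apply: card_le_trans (ultra_tower_card pc towT) _.
  by apply: (card_le_inj (in2W finj)) => _ [y Ty <-]; exists y => //; left.
split; first by move=> _ [y finy <-]; exists y => //; right.
split.
  apply: card_le_trans (card_image_le _ _) _.
  exact: countable_finite_sets.
split; first exact: gamma_like_binom.
(* Tower members are infinite and [f] is injective, so exactly the image of [T] remains. *)
have -> : f @` (T `|` finite_set) `\` f @` finite_set = f @` T.
  have [Tinf _ _ _] := towT; apply/seteqP; split.
    by move=> _ [[y [Ty|finy] <-] nfin]; [exists y|case: nfin; exists y].
  move=> _ [y Ty <-]; split; first by exists y => //; left.
  by move=> [z finz /finj zy]; apply: (Tinf y Ty); rewrite -zy.
exact: ultra_tower_not_split.
Qed.
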